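(* Let $\kappa\in\mathbb{Z}_{\ge0}^n$, and let $\mathcal{P}_1=([n],f_1)$ and $\mathcal{P}_2=([n],f_2)$ be polymatroids with associated $\kappa$-caged M-convex sets $J_1$ and $J_2$. Then the rank function of the $\kappa$-polymatroid union $J_1\vee J_2=\mathrm{Ret}_\kappa(J_1+J_2)$ is $$f_\vee(X)=\min_{Y\subseteq X}\big(f_1(Y)+f_2(Y)+\kappa(X\setminus Y)\big)\qquad (X\subseteq[n]).$$
   Context: Let $[n]=\{1,\dots,n\}$, let $e_i$ be the $i$-th standard basis vector, and order $\mathbb{Z}^n$ coordinatewise; $\kappa(S)=\sum_{i\in S}\kappa_i$. A polymatroid $([n],f)$ is given by a rank function $f\colon2^{[n]}\to\mathbb{Z}_{\ge0}$ that is normalized ($f(\varnothing)=0$), monotone and submodular. An M-convex set on $[n]$ of rank $r$ is a nonempty $J\subseteq\{\alpha\in\mathbb{Z}_{\ge0}^n:\alpha_1+\cdots+\alpha_n=r\}$ such that for all $\alpha,\beta\in J$ and $i$ with $\alpha_i<\beta_i$ there is $j$ with $\alpha_j>\beta_j$ and $\alpha+e_i-e_j,\ \beta-e_i+e_j\in J$. It is $\kappa$-caged if $\alpha\le\kappa$ for all $\alpha\in J$. The rank function of $J$ is $f_J(A)=\max\{\sum_{i\in A}\alpha_i:\alpha\in J\}$; $J\mapsto f_J$ is a bijection between M-convex sets on $[n]$ and polymatroid rank functions on $[n]$, whose inverse sends $f$ to its associated M-convex set $\{\alpha\in\mathbb{Z}_{\ge0}^n:\sum_{i\in S}\alpha_i\le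 f(S)\ \forall S\subseteq[n],\ \sum_{i\in[n]}\alpha_i=f([n])\}$. $J_1+J_2=\{\alpha_1+\alpha_2:\alpha_t\in J_t\}$ is the Minkowski sum (an M-convex set). $\mathrm{Ret}_\kappa(J)$ is the set of coordinatewise maximal elements of $\{\mathrm{proj}_\kappa(\alpha):\alpha\in J\}$, where $\mathrm{proj}_\kappa(\alpha)_i=\min(\alpha_i,\kappa_i)$; it is a $\kappa$-caged M-convex set. *)

(* Defs.v *)
From mathcomp Require Import all_boot.

Set Implicit Arguments.
Unset Strict Implicit.
Unset Printing Implicit Defensive.

(* Points of Z_{>=0}^n.  The ground set {1, ..., n} is 'I_n; finite functions
   are used so that equality of points is extensional.  Sets of points are
   Prop-valued predicates. *)
Definition vec (n : nat) := {ffun 'I_n -> nat}.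

Definition vecset (n : nat) := vec n -> Prop.

Definition le_vec (n : nat) (a b : vec n) : Prop := forall i, a i <= b i.

Definition add_vec (n : nat) (a b : vec n) : vec n := [ffun i => a i + b i].

Definition sum_on (n : nat) (a : vec n) (S : {set 'I_n}) : nat :=
  \sum_(i in S) a i.

Record polymatroid (n : nat) (f : {set 'I_n} -> nat) : Prop := Polymatroid {
  polymatroid_normalized : f set0 = 0;
  polymatroid_monotone :
    forall A B : {set 'I_n}, A \subset B -> f A <= f B;
  polymatroid_submodular :
    forall A B : {set 'I_n}, f (A :|: B) + f (A :&: B) <= f A + f B }.

(* The M-convex set associated with the rank function f. *)
Definition associated_set (n : nat) (f : {set 'I_n} -> nat) : vecset n :=
  fun a => (forall S : {set 'I_n}, sum_on a S <= f S)
           /\ sum_on a [set: 'I_n] = f [set: 'I_n].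

Definition caged (n : nat) (kappa : vec n) (J : vecset n) : Prop :=
  forall a, J a -> le_vec a kappa.

(* f(A) is the maximum of sum_on a A over a in J, for every A.  The maximum is
   specified by attainment and upper bound, since J is a Prop-valued predicate;
   J determines f uniquely, and J must be nonempty. *)
Definition is_rank_function (n : nat) (J : vecset n) (f : {set 'I_n} -> nat)
    : Prop :=
  forall A : {set 'I_n},
    (exists2 a, J a & sum_on a A = f A)
    /\ (forall a, J a -> sum_on a A <= f A).

Definition minkowski_sum (n : nat) (J1 J2 : vecset n) : vecset n :=
  fun a => exists a1 a2, [/\ J1 a1, J2 a2 & a = add_vec a1 a2].

Definition proj (n : nat) (kappa a : vec n) : vec n :=
  [ffun i => minn (a i) (kappa i)].

Definition proj_image (n : nat) (kappa : vec n) (J : vecset n) : vecset n :=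
  fun b => exists2 a, J a & b = proj kappa a.

Definition maximal_elements (n : nat) (K : vecset n) : vecset n :=
  fun b => K b /\ (forall c, K c -> le_vec b c -> c = b).

Definition Ret (n : nat) (kappa : vec n) (J : vecset n) : vecset n :=
  maximal_elements (proj_image kappa J).

Definition polymatroid_union (n : nat) (kappa : vec n) (J1 J2 : vecset n)
    : vecset n :=
  Ret kappa (minkowski_sum J1 J2).

(* Minimum of F over the subsets of X; set0 only witnesses that there is such
   a subset. *)
Definition min_subsets (n : nat) (X : {set 'I_n}) (F : {set 'I_n} -> nat)
    : nat :=
  F [arg min_(Y < set0 | Y \subset X) F Y].

(* Main.v *)
Require Import Defs.
From mathcomp Require Import all_boot.
From mathcomp Require Import order ssralg ssrnum ssrint zify.
From Stdlib Require Import Classical.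

Set Implicit Arguments.
Unset Strict Implicit.
Unset Printing Implicit Defensive.

(** Put g = f1 + f2.  Every element of the union is bounded on Y by f1 + f2 and
    on X :\: Y by kappa, so the content is attainment: a point of the Minkowski
    sum whose truncation has weight at least g Y + kappa (X \ Y) on X, for some
    subset Y of X.

    The greedy lemma [greedy_extension] says that a maximal point x of the
    independence polytope of g under a cap c comes with a tight set, outside of
    which x meets the cap.  Capping by kappa on X and by 0 elsewhere, it gives
    an independent x <= kappa with x(X) >= g Y + kappa (X \ Y)
    ([truncated_rank_attained]).  With a cap that no independent point reaches,
    it extends x to a base b of g ([base_above]).

    It remains to write b as a sum of a base of f1 and a base of f2
    ([base_decomposition]).  This is the integral sandwich theorem [sandwich]:
    an integral modular function fits between b - f2 and f1.  As in the
    Hahn-Banach theorem its values are chosen one element at a time, and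
    submodularity is exactly what makes the interval of admissible values
    nonempty.

    Finally any point of a caged set lies below a maximal one, and the upper
    bound prevents the weight on X from growing. *)

(** * The integral sandwich theorem *)

Section Sandwich.

Import Order.TTheory GRing.Theory Num.Theory.
Local Open Scope ring_scope.

Variable T : finType.
Implicit Types (f h : {set T} -> int) (A B E S : {set T}) (e : T).

Definition submodular f :=
  forall A B, f (A :|: B) + f (A :&: B) <= f A + f B.

(** The constraint that remains on a modular m <= f, off e, once m e = t is
    decided; ignoring e in the argument keeps it defined on all sets. *)
Definition fix_value f e t : {set T} -> int :=
  fun S => Num.min (f (S :\ e)) (f (e |: S) - t).

Lemma setDU1 A B e : (A :\ e) :|: (B :\ e) = (A :|: B) :\ e.
Proof. by apply/setP=> i; rewrite !inE; case: (i == e). Qed.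

Lemma setDI1 A B e : (A :\ e) :&: (B :\ e) = (A :&: B) :\ e.
Proof. by apply/setP=> i; rewrite !inE; case: (i == e). Qed.

Lemma setUU1 A B e : (e |: A) :|: (e |: B) = e |: (A :|: B).
Proof. by apply/setP=> i; rewrite !inE; case: (i == e). Qed.

Lemma setUI1 A B e : (e |: A) :&: (e |: B) = e |: (A :&: B).
Proof. by apply/setP=> i; rewrite !inE; case: (i == e). Qed.

Lemma setD1UU1 A B e : (A :\ e) :|: (e |: B) = e |: (A :|: B).
Proof. by apply/setP=> i; rewrite !inE; case: (i == e); rewrite ?orbT. Qed.

Lemma setD1IU1 A B e : (A :\ e) :&: (e |: B) = (A :&: B) :\ e.
Proof. by apply/setP=> i; rewrite !inE; case: (i == e). Qed.

(** A submodular function minimised over a coordinate stays submodular: the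
    minimisers for A and B combine into candidates for the union and the
    intersection. *)
Lemma fix_value_submodular f e t :
  submodular f -> submodular (fix_value f e t).
Proof.
move=> sub_f A B; rewrite /fix_value.
have := sub_f (A :\ e) (B :\ e); rewrite setDU1 setDI1.
have := sub_f (e |: A) (e |: B); rewrite setUU1 setUI1.
have := sub_f (A :\ e) (e |: B); rewrite setD1UU1 setD1IU1.
have := sub_f (B :\ e) (e |: A); rewrite setD1UU1 setD1IU1 (setUC B) (setIC B).
lia.
Qed.

(** All lower bounds - h (e |: A) - f A on the value at e are below all upper
    bounds f (e |: B) + h B: uncross f at A, e |: B and h at B, e |: A. *)
Lemma admissible_value f h e :
    submodular f -> submodular h -> (forall S, 0 <= f S + h S) ->
  exists t : int, forall S,
    - h (e |: S) - f (S :\ e) <= t /\ t <= f (e |: S) + h (S :\ e).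
Proof.
move=> sub_f sub_h ge0.
pose lower S := - h (e |: S) - f (S :\ e).
case: (@arg_maxP _ int _ set0 xpredT lower isT) => A _ maxA.
exists (lower A) => S; split; first exact: maxA.
have := sub_f (A :\ e) (e |: S); rewrite setD1UU1 setD1IU1.
have := sub_h (S :\ e) (e |: A); rewrite setD1UU1 setD1IU1 (setUC S) (setIC S).
have := ge0 (e |: (A :|: S)); have := ge0 ((A :&: S) :\ e).
by rewrite /lower; lia.
Qed.

Lemma sum_intD1 (F : T -> int) S e : e \in S ->
  \sum_(i in S) F i = F e + \sum_(i in S :\ e) F i.
Proof. exact: big_setD1. Qed.

(** The supermodular lower bound is written - h, so that both bounds are
    updated by [fix_value] and the hypothesis is f + h >= 0. *)
Lemma sandwich f h E :
    submodular f -> submodular h -> f set0 = 0 -> h set0 = 0 ->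
    (forall S, 0 <= f S + h S) ->
  exists m : T -> int, forall S, S \subset E ->
    - h S <= \sum_(i in S) m i /\ \sum_(i in S) m i <= f S.
Proof.
have [k] := ubnP #|E|; elim: k E f h => // k IHk E f h leEk.
move=> sub_f sub_h f0 h0 ge0.
have [-> | [e eE]] := set_0Vmem E.
  exists (fun=> 0) => S; rewrite subset0 => /eqP ->.
  by rewrite big_set0 f0 h0; lia.
have [t tP] := admissible_value e sub_f sub_h ge0.
have set0D : set0 :\ e = set0 :> {set T} by rewrite set0D.
have [||||||m mP] := IHk (E :\ e) (fix_value f e t) (fix_value h e (- t)).
- by rewrite (cardsD1 e) eE in leEk; lia.
- exact: fix_value_submodular.
- exact: fix_value_submodular.
- by have := tP set0; rewrite /fix_value set0D; lia.
- by have := tP set0; rewrite /fix_value set0D; lia.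
- move=> S; have := tP S; have := ge0 (S :\ e); have := ge0 (e |: S).
  by rewrite /fix_value; lia.
exists (fun i => if i == e then t else m i) => S sSE.
have sum_off (A : {set T}) : e \notin A ->
    \sum_(i in A) (if i == e then t else m i) = \sum_(i in A) m i.
  move=> eA; apply: eq_bigr => i iA; case: eqP => // ie.
  by rewrite -ie iA in eA.
have := mP (S :\ e) (setSD _ sSE); rewrite /fix_value.
have -> : (S :\ e) :\ e = S :\ e.
  by apply/setP=> i; rewrite !inE; case: (i == e).
have [eS | eS] := boolP (e \in S).
  rewrite (sum_intD1 _ eS) eqxx sum_off ?setD11 // setD1K //; lia.
rewrite sum_off // (setDidPl _) 1?disjoint_sym ?disjoints1 //; lia.
Qed.

End Sandwich.

(** * Maximal points and tight sets *)

Section Vectors.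

Variable n : nat.
Implicit Types (a b c x : vec n) (A B S T X Y : {set 'I_n}).
Implicit Types (f g : {set 'I_n} -> nat).

Lemma le_sum_on a b S : le_vec a b -> sum_on a S <= sum_on b S.
Proof. by move=> le_ab; apply: leq_sum => i _. Qed.

Lemma sum_on_add a b S : sum_on (add_vec a b) S = sum_on a S + sum_on b S.
Proof. by rewrite -big_split; apply: eq_bigr => i _; rewrite ffunE. Qed.

Lemma sum_onID a S A : sum_on a S = sum_on a (S :&: A) + sum_on a (S :\: A).
Proof. exact: big_setID. Qed.

Lemma sum_onD1 a S i : i \in S -> sum_on a S = a i + sum_on a (S :\ i).
Proof. exact: big_setD1. Qed.

Lemma sum_onUI a A B :
  sum_on a (A :|: B) + sum_on a (A :&: B) = sum_on a A + sum_on a B.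
Proof.
rewrite (sum_onID a (A :|: B) A) (sum_onID a B A) setUK setDUl setDv set0U.
by rewrite (setIC B); lia.
Qed.

Lemma exists_maximal_above (K : vecset n) c a :
  caged c K -> K a -> exists2 b, maximal_elements K b & le_vec a b.
Proof.
move=> cagedK.
have [k] := ubnP (sum_on c setT - sum_on a setT).
elim: k a => // k IHk a ltk Ka.
have [maxa | ] := classic (forall b, K b -> le_vec a b -> b = a).
  by exists a.
move=> /not_all_ex_not [b /(imply_to_and (K b)) [Kb]].
move=> /(imply_to_and (le_vec a b)) [le_ab ne_ba].
have lt_ab : sum_on a setT < sum_on b setT.
  rewrite ltn_neqAle le_sum_on // andbT; apply/negP => /eqP eq_sum.
  apply: ne_ba; apply/ffunP => i; apply/eqP.
  rewrite eqn_leq le_ab andbT -(leq_add2r (sum_on a (setT :\ i))).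
  by rewrite -sum_onD1 // eq_sum (sum_onD1 b (in_setT i)) leq_add2l le_sum_on.
have le_bc := le_sum_on setT (cagedK _ Kb).
have [|b' maxb' le_bb'] := IHk b _ Kb; first lia.
by exists b' => // i; apply: leq_trans (le_bb' i).
Qed.

Definition independent f a := forall S, sum_on a S <= f S.

Lemma tightU f x A B : polymatroid f -> independent f x ->
  sum_on x A = f A -> sum_on x B = f B -> sum_on x (A :|: B) = f (A :|: B).
Proof.
move=> Pf indx tA tB; have := polymatroid_submodular Pf A B.
have := indx (A :|: B); have := indx (A :&: B); have := sum_onUI x A B; lia.
Qed.

(** Increasing a maximal x at an element where it is below the cap must violate
    a constraint, so this element lies in a tight set; tight sets are closed
    under union. *)
Lemma greedy_extension f c x0 : polymatroid f -> independent f x0 ->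
    le_vec x0 c ->
  exists x T, [/\ independent f x, le_vec x0 x, le_vec x c,
    sum_on x T = f T & forall i, i \notin T -> x i = c i].
Proof.
move=> Pf ind0 le0c.
pose K : vecset n := fun x => independent f x /\ le_vec x c.
have cagedK : caged c K by move=> x [].
have [x [[indx lexc] maxx] le0x] :=
  exists_maximal_above cagedK (conj ind0 le0c).
pose T := \bigcup_(A | sum_on x A == f A) A.
exists x, T; split=> //.
  apply: (big_ind (fun A => sum_on x A = f A)) => [|A B|A /eqP //].
    by rewrite (polymatroid_normalized Pf) /sum_on big_set0.
  exact: tightU.
move=> i niT; apply/eqP; rewrite eqn_leq lexc leqNgt; apply/negP => ltxc.
have notin_tight S : i \in S -> sum_on x S < f S.
  move=> iS; rewrite ltn_neqAle indx andbT; apply: contra niT => tS.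
  by apply/bigcupP; exists S.
pose x' : vec n := [ffun j => x j + (j == i)].
have sum_x' S : sum_on x' S = sum_on x S + (i \in S).
  rewrite /sum_on (eq_bigr (fun j => x j + (j == i))) => [|j _]; last first.
    by rewrite ffunE.
  rewrite big_split /=; congr (_ + _).
  have [iS | niS] := boolP (i \in S).
    rewrite (big_setD1 i iS) /= eqxx big1 // => j.
    by rewrite !inE => /andP[/negPf ->].
  by rewrite big1 // => j jS; case: eqP => // ji; rewrite -ji jS in niS.
have Kx' : K x'.
  split=> [S | j].
    rewrite sum_x'; have [/notin_tight | _] := boolP (i \in S); first by lia.
    by rewrite addn0.
  by rewrite ffunE; case: eqP => [-> | _]; have := lexc j; lia.
have le_xx' : le_vec x x' by move=> j; rewrite ffunE leq_addr.
have := maxx x' Kx' le_xx' => /ffunP/(_ i)/eqP.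
by rewrite ffunE eqxx -[eqbRHS]addn0 eqn_add2l.
Qed.

Lemma truncated_rank_attained f c X : polymatroid f ->
  exists x Y, [/\ independent f x, le_vec x c, Y \subset X
    & f Y + sum_on c (X :\: Y) <= sum_on x X].
Proof.
move=> Pf.
pose zero : vec n := [ffun=> 0].
pose cX : vec n := [ffun i => if i \in X then c i else 0].
have ind0 : independent f zero.
  by move=> S; rewrite /sum_on big1 // => i _; rewrite ffunE.
have le0 : le_vec zero cX by move=> i; rewrite ffunE.
have [x [T [indx _ lex tT capT]]] := greedy_extension Pf ind0 le0.
exists x, (X :&: T); split=> //; last 1 first.
- rewrite setDIr setDv set0U (sum_onID x X T); apply: leq_add.
    (* x vanishes off X, so the weight of the tight set T sits on X :&: T. *)
    apply: (leq_trans (polymatroid_monotone Pf (subsetIr X T))).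
    rewrite -tT (sum_onID x T X) setIC -[leqRHS]addn0 leq_add2l.
    rewrite /sum_on big1 // => i /setDP[_ /negPf niX].
    by have := lex i; rewrite ffunE niX leqn0 => /eqP.
  apply: leq_sum => i /setDP[iX niT].
  by rewrite capT // ffunE iX.
- by move=> i; apply: (leq_trans (lex i)); rewrite ffunE; case: ifP.
- exact: subsetIl.
Qed.

(** Coordinates of independent points are at most f setT, so under a larger cap
    the tight set of the greedy lemma has to be the whole ground set. *)
Lemma base_above f x : polymatroid f -> independent f x ->
  exists2 b, associated_set f b & le_vec x b.
Proof.
move=> Pf indx.
have ind_lt y : independent f y -> forall i, y i < (f setT).+1.
  move=> indy i; rewrite ltnS; apply: leq_trans (indy setT).
  by rewrite (sum_onD1 _ (in_setT i)) leq_addr.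
pose c : vec n := [ffun=> (f setT).+1].
have lexc : le_vec x c by move=> i; rewrite ffunE ltnW ?ind_lt.
have [b [T [indb lexb _ tT capT]]] := greedy_extension Pf indx lexc.
exists b => //; split=> //; rewrite -[setT](_ : T = _) //.
apply/setP => i; rewrite in_setT; apply: contraT => /capT.
by rewrite ffunE; have := ind_lt b indb i; lia.
Qed.

(** * Minkowski sums of bases *)

Lemma polymatroid_add f1 f2 :
  polymatroid f1 -> polymatroid f2 -> polymatroid (fun S => f1 S + f2 S).
Proof.
case=> z1 m1 s1 [z2 m2 s2]; split=> [|A B sAB|A B].
- by rewrite z1 z2.
- by rewrite leq_add ?m1 ?m2.
- by have := s1 A B; have := s2 A B; lia.
Qed.

(** The sandwiched function m <= f1 with b - m <= f2 may a priori be negative.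
    Because b is a base, both parts have full weight on the ground set; then
    the bound on the complement of i, with monotonicity, makes the value at i
    nonnegative. *)
Lemma base_decomposition f1 f2 b : polymatroid f1 -> polymatroid f2 ->
    associated_set (fun S => f1 S + f2 S) b ->
  minkowski_sum (associated_set f1) (associated_set f2) b.
Proof.
move=> P1 P2 [indb totb].
pose f S : int := Posz (f1 S).
pose h S : int := (Posz (f2 S) - Posz (sum_on b S))%R.
have sub_f : submodular f.
  by move=> A B; have := polymatroid_submodular P1 A B; rewrite /f; lia.
have sub_h : submodular h.
  move=> A B; have := polymatroid_submodular P2 A B.
  by have := sum_onUI b A B; rewrite /h; lia.
have f0 : f set0 = 0%R by rewrite /f (polymatroid_normalized P1).
have h0 : h set0 = 0%R.
  by rewrite /h (polymatroid_normalized P2) /sum_on big_set0.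
have ge0 S : (0 <= f S + h S)%R by have := indb S; rewrite /f /h; lia.
have [m mP'] := sandwich setT sub_f sub_h f0 h0 ge0.
have mP S := mP' S (subsetT S).
have m_bounds i : (0 <= m i)%R /\ (m i <= Posz (b i))%R.
  have := mP setT; have := mP (setT :\ i).
  rewrite (sum_intD1 _ (in_setT i)) /f /h.
  have := polymatroid_monotone P1 (subsetT (setT :\ i)).
  have := polymatroid_monotone P2 (subsetT (setT :\ i)).
  have := sum_onD1 b (in_setT i).
  by move: totb; lia.
pose a1 : vec n := [ffun i => absz (m i)].
pose a2 : vec n := [ffun i => b i - a1 i].
have eq_b : b = add_vec a1 a2.
  apply/ffunP=> i; have le_mb : absz (m i) <= b i by have := m_bounds i; lia.
  by rewrite !ffunE subnKC.
have sum_a1 S : (\sum_(i in S) m i)%R = Posz (sum_on a1 S).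
  rewrite /sum_on (big_morph Posz PoszD (erefl _)); apply: eq_bigr => i _.
  by rewrite ffunE; have := m_bounds i; lia.
have boundP S : sum_on a1 S <= f1 S /\ sum_on a2 S <= f2 S.
  have := mP S; rewrite sum_a1 /f /h {1}eq_b sum_on_add; lia.
have := boundP setT; move: totb; rewrite {1}eq_b sum_on_add => totb bT.
exists a1, a2; split=> //; split; try (by move=> S; case: (boundP S)); lia.
Qed.

(** * The rank of the union *)

Lemma union_rank_le kappa f1 f2 a X Y : Y \subset X ->
    proj_image kappa
      (minkowski_sum (associated_set f1) (associated_set f2)) a ->
  sum_on a X <= f1 Y + f2 Y + sum_on kappa (X :\: Y).
Proof.
move=> sYX [_ [a1 [a2 [[ind1 _] [ind2 _] ->]]] ->].
rewrite (sum_onID _ X Y) (setIidPr sYX); apply: leq_add; last first.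
  by apply: le_sum_on => i; rewrite ffunE geq_minr.
apply: leq_trans (leq_add (ind1 Y) (ind2 Y)).
by rewrite -sum_on_add; apply: le_sum_on => i; rewrite ffunE geq_minl.
Qed.

Lemma union_rank_attained kappa f1 f2 X : polymatroid f1 -> polymatroid f2 ->
  exists a Y, [/\ Y \subset X,
    polymatroid_union kappa (associated_set f1) (associated_set f2) a
    & f1 Y + f2 Y + sum_on kappa (X :\: Y) <= sum_on a X].
Proof.
move=> P1 P2; have P12 := polymatroid_add P1 P2.
have [x [Y [indx lexk sYX le_xX]]] := truncated_rank_attained kappa X P12.
have [b baseb lexb] := base_above P12 indx.
have Jb := base_decomposition P1 P2 baseb.
pose K := proj_image kappa
            (minkowski_sum (associated_set f1) (associated_set f2)).
have Kb : K (proj kappa b) by exists b.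
have cagedK : caged kappa K by move=> _ [a _ ->] i; rewrite ffunE geq_minr.
have [a maxa le_ba] := exists_maximal_above cagedK Kb.
exists a, Y; split=> //; apply: (leq_trans le_xX); apply: le_sum_on => i.
by apply: leq_trans (le_ba i); rewrite ffunE leq_min lexb lexk.
Qed.

End Vectors.

Theorem theorem4p14 (n : nat) (kappa : vec n) (f1 f2 : {set 'I_n} -> nat)
    (P1 : polymatroid f1) (P2 : polymatroid f2)
    (caged1 : caged kappa (associated_set f1))
    (caged2 : caged kappa (associated_set f2)) :
  is_rank_function
    (polymatroid_union kappa (associated_set f1) (associated_set f2))
    (fun X : {set 'I_n} =>
       min_subsets X (fun Y => f1 Y + f2 Y + sum_on kappa (X :\: Y))).
Proof.
move=> X; rewrite /min_subsets.
case: arg_minnP => [|Y sYX minY]; first exact: sub0set.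
split=> [|a [Ka _]]; last exact: union_rank_le Ka.
have [a [Z [sZX Ja le_aX]]] := union_rank_attained kappa X P1 P2.
exists a => //; apply/eqP; rewrite eqn_leq (union_rank_le sYX (proj1 Ja)).
exact: leq_trans (minY _ sZX) le_aX.
Qed.
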